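(* Let $G$ be a finite group and let $S$ be a set of generators of $G$ with $e\in S=S^{-1}$. Let $\mathfrak{X}_C$ be the configuration coming from the Cayley graph $\mathrm{Cay}(G,S)$, and let $D=\mathrm{diam}\,\mathrm{Cay}(G,S)$. Then the number $WL(\mathfrak{X}_C)$ of nontrivial iterations of the Weisfeiler-Leman algorithm applied to $\mathfrak{X}_C$ satisfies $$WL(\mathfrak{X}_C)=\begin{cases}\lceil\log_2(D-1)\rceil & \text{if for every } g\in G \text{ there is exactly one } g'\in G \text{ with } d(g,g')=D,\\ \lceil \log_2 D\rceil & \text{otherwise.}\end{cases}$$
   Context: The Cayley graph $\mathrm{Cay}(G,S)$ has vertex set $G$ and edge set $\{(g,sg): g\in G, s\in S\}$; $d(g,g')$ denotes the length of a shortest directed path from $g$ to $g'$ and $D$ is the maximum of $d$ over all pairs. The configuration $\mathfrak{X}_C$ is the pair $(G,c)$ with $c(g_1,g_2)=g_2g_1^{-1}$ if $g_2g_1^{-1}\in S$ and $c(g_1,g_2)=\emptyset$ (a special symbol) otherwise. Weisfeiler-Leman algorithm: for a set $\Gamma$ with colouring $c:\Gamma^2\to\mathcal{C}$, put $c^{(0)}=c$, $\mathcal{C}^{(0)}=\mathcal{C}$, and define $c^{(h+1)}(v_1,v_2)$ to be the tuple consisting of $c^{(h)}(v_1,v_2)$ together with the family of numbers $\left|\{w\in\Gamma: c^{(h)}(v_1,w)=c_1,\ c^{(h)}(w,v_2)=c_2\}\right|$ indexed by $(c_1,c_2)\in\mathcal{C}^{(h)}\times\mathcal{C}^{(h)}$;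 $\mathcal{C}^{(h+1)}$ is the set of values of $c^{(h+1)}$. The number of nontrivial iterations $WL$ is the least $h\geq0$ such that the partition of $\Gamma^2$ into colour classes of $c^{(h+1)}$ equals that of $c^{(h)}$. *)

(* Defs.v *)
From HB Require Import structures.
From mathcomp Require Export all_boot all_fingroup.

Set Implicit Arguments.
Unset Strict Implicit.
Unset Printing Implicit Defensive.

Section Distance.

Variables (T : finType) (e : rel T).

Definition walk (n : nat) (x y : T) : bool :=
  [exists p : n.-tuple T, path e x p && (last x p == y)].

Lemma walk_ex (x y : T) : exists n, connect e x y ==> walk n x y.
Proof.
case: (boolP (connect e x y)) => [/connectP[p ep ->]|_]; last by exists 0.
by exists (size p); apply/existsP; exists (in_tuple p); rewrite ep eqxx.
Qed.

(* Least length of a directed path from x to y; the junk value for an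
   unreachable y is 0. *)
Definition dist (x y : T) : nat := ex_minn (walk_ex x y).

Definition diam : nat := \max_(x : T) \max_(y : T) dist x y.

End Distance.

Section WeisfeilerLeman.

Variable V : finType.

Record config := Config {
  colour : finType;
  colouring : V * V -> colour
}.

Definition wl_value (X : config) (v : V * V) :
    colour X * {ffun colour X * colour X -> nat} :=
  (colouring X v,
   [ffun k : colour X * colour X =>
      #|[set w : V | (colouring X (v.1, w) == k.1)
                     && (colouring X (w, v.2) == k.2)]|]).

(* The new colour set consists of the attained values only; seq_sub s is the
   finite type of the elements of s. *)
Definition wl_step (X : config) : config :=
  @Config (seq_sub (codom (@wl_value X)))
          (fun v => SeqSub (codom_f (@wl_value X) v)).

Definition wl_iter (h : nat) (X : config) : config := iter h wl_step X.

Definition colour_classes (X : config) : {set {set V * V}} :=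
  preim_partition (colouring X) [set: V * V].

Definition wl_stable (X : config) (h : nat) : bool :=
  colour_classes (wl_iter h.+1 X) == colour_classes (wl_iter h X).

Lemma wl_stable_ex (X : config) : exists h, wl_stable X h.
Proof.
pose E h := [set p : (V * V) * (V * V) |
  colouring (wl_iter h X) p.1 == colouring (wl_iter h X) p.2].
have sE h : E h.+1 \subset E h.
  apply/subsetP => -[u v]; rewrite !inE /= => /eqP [-> _]; exact: eqxx.
have stE h : E h.+1 = E h -> wl_stable X h.
  move=> EE; rewrite /wl_stable /colour_classes /preim_partition.
  apply/eqP/eq_imset => u; apply/setP => v; rewrite !inE /=.
  by move/setP/(_ (u, v)): EE; rewrite !inE.
suff [h /eqP /stE]: exists h, E h.+1 == E h by exists h.
have [n leEn] : exists n, #|E 0| < n by exists #|E 0|.+1.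
elim: n 0 leEn => // n IHn h ltE.
have [EE|nE] := eqVneq (E h.+1) (E h); first by exists h; apply/eqP.
apply: (IHn h.+1); rewrite ltnS in ltE; apply: leq_trans ltE.
by apply: proper_card; rewrite properEneq nE sE.
Qed.

Definition WL (X : config) : nat := ex_minn (wl_stable_ex X).

End WeisfeilerLeman.

Section Cayley.

Variables (gT : finGroupType) (S : {set gT}).
Local Open Scope group_scope.

Definition cayley : rel gT := fun g g' => [exists s in S, g' == s * g].

(* None is the special symbol for pairs that are not edges. *)
Definition cayley_config : config gT :=
  @Config gT (option gT)
    (fun v => if v.2 * v.1^-1 \in S then Some (v.2 * v.1^-1) else None).

(* When this holds and the diameter D is at most 1 (so #|gT| <= 2), the usual
   ceiling of log_2 (D - 1) is undefined; up_log 2 (D - 1) is then 0. *)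
Definition unique_antipodes : bool :=
  [forall g : gT, #|[set g' : gT | dist cayley g g' == diam cayley]| == 1%N].

End Cayley.

(* Main.v *)
Require Import Defs.

Set Implicit Arguments.
Unset Strict Implicit.
Unset Printing Implicit Defensive.

(** All colourings produced by the algorithm are invariant under right
    translation, so the colour of [(g1, g2)] is a function of [g2 g1^-1].  The
    balls of radius [n] in the Cayley graph are the powers [S ^+ n], and after
    [h] iterations the colour determines [g2 g1^-1] on the ball [B = S ^+ 2 ^ h],
    while all quotients outside [B] share one colour: a refinement step
    recognises the products [b * a] with [a, b] in [B], and for [q] outside
    [B * B] the factorisations [q = b * a] are counted by numbers depending only
    on [#|B|].  Hence the partition is stable exactly when at most one element
    lies outside [S ^+ 2 ^ h], because the powers of [S] grow strictly until
    they fill the group. *)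

Section Kernels.

Variable V : finType.
Implicit Type X : config V.

Lemma preim_partition_eqP (T : finType) (C1 C2 : eqType)
    (f1 : T -> C1) (f2 : T -> C2) :
  reflect (forall x y, (f1 x == f1 y) = (f2 x == f2 y))
    (preim_partition f1 [set: T] == preim_partition f2 [set: T]).
Proof.
apply: (iffP eqP) => [eqP12 x y | eqf].
  have pblockE (C : eqType) (f : T -> C) :
      (y \in pblock (preim_partition f [set: T]) x) = (f x == f y).
    rewrite pblock_equivalence_partition ?inE // => a b c _ _ _.
    by split=> // /eqP ->.
  by rewrite -!pblockE eqP12.
by apply: eq_imset => x; apply/setP => y; rewrite !inE eqf.
Qed.

Lemma wl_step_eqP X u v :
  reflect (colouring X u = colouring X v /\
    forall k1 k2,
      #|[set w | (colouring X (u.1, w) == k1) && (colouring X (w, u.2) == k2)]|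
      = #|[set w | (colouring X (v.1, w) == k1) && (colouring X (w, v.2) == k2)]|)
    (colouring (wl_step X) u == colouring (wl_step X) v).
Proof.
rewrite -val_eqE /=; apply: (iffP eqP) => [[-> /ffunP eqN] | [eqc eqN]].
  by split=> // k1 k2; have := eqN (k1, k2); rewrite !ffunE.
by rewrite /wl_value eqc; congr pair; apply/ffunP => k; rewrite !ffunE eqN.
Qed.

End Kernels.

(** * One refinement step, read on quotients *)

Section Refinement.

Variable gT : finGroupType.
Local Open Scope group_scope.
Implicit Types (B S : {set gT}) (q r : gT).

Definition quot (v : gT * gT) : gT := v.2 * v.1^-1.

Definition ball_eq B q r : bool := (q == r) || (q \notin B) && (r \notin B).

Lemma ball_eq_in B q r : r \in B -> ball_eq B q r = (q == r).
Proof. by rewrite /ball_eq => ->; rewrite andbF orbF. Qed.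

Lemma ball_eq_notin B q r : r \notin B -> ball_eq B q r = (q \notin B).
Proof.
by rewrite /ball_eq => rB; rewrite rB andbT; case: eqVneq => // ->; rewrite rB.
Qed.

Lemma ball_eqxx B q : ball_eq B q q.
Proof. by rewrite /ball_eq eqxx. Qed.

(** The refinement number of a pair [v] with quotient [q]: the middle vertex [w] is replaced by
    [a = w * v.1^-1], so that [q * a^-1] is the quotient of [(w, v.2)]. *)
Definition factor_count (C : eqType) (F : gT -> C) q (k1 k2 : C) : nat :=
  #|[set a | (F a == k1) && (F (q * a^-1) == k2)]|.

Lemma factor_count_notin B (C : eqType) (F : gT -> C) q r k1 k2 :
    (forall a b, (F a == F b) = ball_eq B a b) ->
    q \notin B * B -> r \notin B * B ->
  factor_count F q k1 k2 = factor_count F r k1 k2.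
Proof.
move=> kerF qB rB; rewrite /factor_count.
have divB x a : x \notin B * B -> a \in B -> x * a^-1 \notin B.
  by move=> xB aB; apply: contra xB => xaB; rewrite -(mulgKV a x) mem_mulg.
have divlB x b : x \notin B * B -> b \in B -> b^-1 * x \notin B.
  by move=> xB bB; apply: contra xB => bxB; rewrite -(mulKVg b x) mem_mulg.
have [a0 /eqP <- | noF1] := pickP (fun a => F a == k1); last first.
  by congr #|pred_of_set _|; apply/setP => a; rewrite !inE noF1.
have [b0 /eqP <- | noF2] := pickP (fun b => F b == k2); last first.
  by congr #|pred_of_set _|; apply/setP => a; rewrite !inE !noF2 !andbF.
(* Only [a0] itself can count; its cofactor is outside [B] for [q] and [r] alike, hence has the same
   colour. *)
have [a0B | a0B] := boolP (a0 \in B).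
  congr #|pred_of_set _|; apply/setP => a; rewrite !inE kerF ball_eq_in //.
  case: eqVneq => //= ->; congr (_ == _); apply/eqP.
  by rewrite kerF ball_eq_notin !divB.
(* Only [b0^-1 * x] can count, and it does since it lies outside [B]. *)
have [b0B | b0B] := boolP (b0 \in B).
  have card1 x : x \notin B * B ->
      #|[set a | (F a == F a0) && (F (x * a^-1) == F b0)]| = 1%N.
    move=> xB; rewrite -(cards1 (b0^-1 * x)); congr #|pred_of_set _|.
    apply/setP => a; rewrite !inE !kerF (ball_eq_in _ b0B) (ball_eq_notin _ a0B).
    rewrite (can2_eq (mulgKV a) (mulgK a)) eq_sym (can2_eq (mulKg b0) (mulKVg b0)).
    by case: eqVneq => [-> | _]; rewrite ?divlB ?andbF.
  by rewrite !card1.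
(* Here [a] must avoid [B] and [B^-1 :* x], which are disjoint because [x] is not in [B * B]. *)
have cardC x : x \notin B * B ->
    #|[set a | (F a == F a0) && (F (x * a^-1) == F b0)]| = (#|gT| - (#|B| + #|B|))%N.
  move=> xB.
  have -> : [set a | (F a == F a0) && (F (x * a^-1) == F b0)]
          = ~: (B :|: B^-1 :* x).
    apply/setP => a; rewrite !inE !kerF !ball_eq_notin // negb_or.
    by rewrite mem_rcoset mem_invg invMg invgK.
  rewrite cardsCs setCK cardsU card_rcoset card_invg.
  suff -> : B :&: B^-1 :* x = set0 by rewrite cards0 subn0.
  apply/setP => a; rewrite !inE mem_rcoset mem_invg invMg invgK.
  by case: (boolP (a \in B)) => //= /(divB _ _ xB)/negPf.
by rewrite !cardC.
Qed.

Lemma wl_step_ball_eq B (X : config gT) :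
    1 \in B ->
    (forall u v, (colouring X u == colouring X v) = ball_eq B (quot u) (quot v)) ->
  forall u v, (colouring (wl_step X) u == colouring (wl_step X) v)
              = ball_eq (B * B) (quot u) (quot v).
Proof.
move=> B1 kerX u v; pose F a := colouring X (1, a).
have colE w : colouring X w = F (quot w).
  by apply/eqP; rewrite kerX /quot /= invg1 mulg1 ball_eqxx.
have kerF a b : (F a == F b) = ball_eq B a b.
  by rewrite kerX /quot /= !invg1 !mulg1.
have countE (x : gT * gT) k1 k2 :
    #|[set w | (colouring X (x.1, w) == k1) && (colouring X (w, x.2) == k2)]|
    = factor_count F (quot x) k1 k2.
  rewrite /factor_count -[RHS](card_rcoset _ x.1); congr #|pred_of_set _|.
  apply/setP => w; rewrite mem_rcoset !inE !colE /quot /=.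
  by rewrite invMg invgK -mulgA mulKg.
(* Quotients outside [B * B] are thus outside [B], so they agree in the old colour that the new one
   retains. *)
have sBB a : a \in B -> a \in B * B by move=> aB; rewrite -[a]mulg1 mem_mulg.
apply/wl_step_eqP/idP => [[_ eqN] | eqBB].
  (* For [a] and [b] in [B] the colour classes are singletons, so a positive count for [r] at these
     colours forces [r = b * a]. *)
  have sep q r : (forall k1 k2, factor_count F q k1 k2 = factor_count F r k1 k2) ->
      q \in B * B -> q = r.
    move=> eqFN /mulsgP[b a bB aB q_ba].
    have: 0 < factor_count F q (F a) (F b).
      by apply/card_gt0P; exists a; rewrite inE q_ba mulgK !eqxx.
    rewrite eqFN => /card_gt0P[a']; rewrite inE !kerF !ball_eq_in //.
    by case/andP=> /eqP -> /eqP rb; rewrite q_ba -rb mulgKV.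
  have eqFN k1 k2 : factor_count F (quot u) k1 k2 = factor_count F (quot v) k1 k2.
    by rewrite -!countE.
  have [uB | uB] := boolP (quot u \in B * B).
    by rewrite (sep _ _ eqFN uB) ball_eqxx.
  have [vB | vB] := boolP (quot v \in B * B); last by rewrite ball_eq_notin.
  by rewrite (sep (quot v) (quot u)) ?ball_eqxx.
have [eqq | neq] := eqVneq (quot u) (quot v).
  by split=> [|k1 k2]; rewrite ?countE ?colE eqq.
move: eqBB; rewrite /ball_eq (negPf neq) /= => /andP[uB vB].
split=> [|k1 k2]; last by rewrite !countE; exact: factor_count_notin kerF uB vB.
by apply/eqP; rewrite kerX ball_eq_notin; apply: contra (sBB _) _.
Qed.

End Refinement.

(** * Balls and distances in the Cayley graph *)

Section Cayley.

Variables (gT : finGroupType) (S : {set gT}).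
Local Open Scope group_scope.
Hypotheses (genS : <<S>> = [set: gT]) (S1 : 1 \in S).

Lemma expgs_mono m n : m <= n -> S ^+ m \subset S ^+ n.
Proof.
move/subnKC <-; elim: {n}(n - m)%N => [|k IHk]; first by rewrite addn0.
by apply: subset_trans IHk _; rewrite addnS expgSr mulg_subl.
Qed.

Lemma expgs_full : exists N, S ^+ N = [set: gT].
Proof.
have [N eqN] := gen_expgs S; exists N; rewrite -genS eqN.
by congr (_ ^+ _); apply/setP => x; rewrite !inE; case: eqVneq => // ->.
Qed.

(** Equality of two consecutive powers propagates upwards, and some power is the whole group. *)
Lemma expgs_fix n : S ^+ n.+1 = S ^+ n -> S ^+ n = [set: gT].
Proof.
move=> fixn; have [N fullN] := expgs_full.
have fixk k : S ^+ (n + k) = S ^+ n.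
  by elim: k => [|k IHk]; rewrite ?addn0 // addnS expgSr IHk -expgSr.
apply/eqP; rewrite eqEsubset subsetT /= -fullN -(fixk N).
exact: expgs_mono (leq_addl _ _).
Qed.

(** Edges multiply on the left, so the first step of a walk supplies the rightmost factor of the
    quotient. *)
Lemma walk_cayley n g g' : walk (cayley S) n g g' = (g' * g^-1 \in S ^+ n).
Proof.
elim: n g => [|n IHn] g.
  rewrite expg0 inE -eq_mulgV1 eq_sym; apply/existsP/idP => [[p]|gg'].
    by rewrite (tuple0 p).
  by exists [tuple]; rewrite /= gg'.
apply/existsP/idP => [[p] | ].
  case/tupleP: p => z p /= /andP[/andP[/exists_inP[s sS /eqP z_sg] pz] lz].
  have: walk (cayley S) n z g' by apply/existsP; exists p; rewrite pz.
  rewrite IHn z_sg invMg mulgA expgSr => g'S.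
  by rewrite -(mulgKV s (g' * g^-1)) mem_mulg.
rewrite expgSr => /mulsgP[x s xS sS g'g].
have: walk (cayley S) n (s * g) g' by rewrite IHn invMg mulgA g'g mulgK.
case/existsP => p /andP[pz lz]; exists (cons_tuple (s * g) p) => /=.
by rewrite pz lz !andbT; apply/exists_inP; exists s.
Qed.

Lemma dist_cayley_leq g g' n :
  (dist (cayley S) g g' <= n) = (g' * g^-1 \in S ^+ n).
Proof.
have conn : connect (cayley S) g g'.
  have [N fullN] := expgs_full.
  have: walk (cayley S) N g g' by rewrite walk_cayley fullN inE.
  by case/existsP => p /andP[pg /eqP lg]; apply/connectP; exists p.
rewrite /dist; case: ex_minnP => m; rewrite conn /= walk_cayley => mS minm.
apply/idP/idP => [/expgs_mono/subsetP -> // | nS].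
by apply: minm; rewrite walk_cayley.
Qed.

Lemma diam_cayley_leq n : (diam (cayley S) <= n) = (S ^+ n == [set: gT]).
Proof.
rewrite -subTset; apply/bigmax_leqP/subsetP => [leD q _ | fulln g _].
  have /bigmax_leqP/(_ q isT) := leD 1 isT.
  by rewrite dist_cayley_leq invg1 mulg1.
by apply/bigmax_leqP => g' _; rewrite dist_cayley_leq fulln.
Qed.

(** Right translation preserves distances, so the antipodes of [1] alone decide
    [unique_antipodes]. *)
Lemma cayley_antipodesE g :
  [set g' | dist (cayley S) g g' == diam (cayley S)]
  = [set q | dist (cayley S) 1 q == diam (cayley S)] :* g.
Proof.
apply/setP => g'; rewrite mem_rcoset !inE; congr (_ == _).
have leqE n : (dist (cayley S) g g' <= n) = (dist (cayley S) 1 (g' * g^-1) <= n).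
  by rewrite !dist_cayley_leq invg1 mulg1.
by apply/anti_leq; rewrite leqE leqnn -leqE leqnn.
Qed.

Lemma unique_antipodesE :
  unique_antipodes S = (#|[set q | dist (cayley S) 1 q == diam (cayley S)]| == 1%N).
Proof.
apply/forallP/idP => [/(_ 1) // | card1 g].
by rewrite cayley_antipodesE card_rcoset.
Qed.

Lemma card_setC_expgs_leq1 n :
  (#|~: (S ^+ n)| <= 1) = (diam (cayley S) - unique_antipodes S <= n).
Proof.
have outE q : (q \in ~: (S ^+ n)) = (n < dist (cayley S) 1 q).
  by rewrite inE ltnNge dist_cayley_leq invg1 mulg1.
have leD q : dist (cayley S) 1 q <= diam (cayley S).
  by apply: leq_trans (leq_bigmax (F := fun g => \max_g' dist _ g g') 1);
     exact: leq_bigmax.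
set D := diam (cayley S) in leD *.
have [leDn | ltnD] := leqP D n.
  rewrite (leq_trans (leq_subr _ _) leDn); move: leDn.
  by rewrite diam_cayley_leq => /eqP ->; rewrite setCT cards0.
have sub : [set q | dist (cayley S) 1 q == D] \subset ~: (S ^+ n).
  by apply/subsetP => q; rewrite outE inE => /eqP ->.
have exD : 0 < #|[set q | dist (cayley S) 1 q == D]|.
  have: ~~ (D <= D.-1) by rewrite -ltnNge prednK // (leq_ltn_trans _ ltnD).
  rewrite diam_cayley_leq -subTset => /subsetPn[q _ qS].
  apply/card_gt0P; exists q; rewrite inE eqn_leq leD /=.
  rewrite -(prednK (leq_ltn_trans (leq0n n) ltnD)) ltnNge.
  by rewrite dist_cayley_leq invg1 mulg1.
rewrite unique_antipodesE -/D; apply/idP/idP => [out1 | ].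
  have -> : #|[set q | dist (cayley S) 1 q == D]| == 1%N.
    by rewrite eqn_leq exD (leq_trans (subset_leq_card sub)).
  (* If [n.+1 < D], the complement of [S ^+ n.+1] is nonempty and lies in that of [S ^+ n], of size
     at most one; the powers would stop growing before filling the group. *)
  rewrite leq_subLR addnC addn1 leqNgt; apply/negP => ltD.
  have out2 : 0 < #|~: (S ^+ n.+1)|.
    rewrite card_gt0 -setCT (inj_eq (@setC_inj gT)) -diam_cayley_leq.
    by rewrite -ltnNge.
  have /eqP/setC_inj/expgs_fix/eqP : ~: (S ^+ n.+1) == ~: (S ^+ n).
    by rewrite eqEcard setCS expgs_mono ?(leq_trans out1).
  by rewrite -diam_cayley_leq leqNgt ltnD.
case: eqP => [card1 | _]; last by rewrite subn0 leqNgt ltnD.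
(* Now [D = n.+1], so everything outside [S ^+ n] is an antipode of [1]. *)
rewrite leq_subLR add1n => leDn; rewrite -card1 subset_leq_card //.
apply/subsetP => q; rewrite outE inE eqn_leq leD => ltnq.
exact: leq_trans leDn ltnq.
Qed.

(** * Iterations on the Cayley configuration *)

Lemma wl_iter_cayley h u v :
  (colouring (wl_iter h (cayley_config S)) u
   == colouring (wl_iter h (cayley_config S)) v)
  = ball_eq (S ^+ (2 ^ h)%N) (quot u) (quot v).
Proof.
elim: h u v => [|h IHh] u v.
  rewrite expg1 /= -!/(quot _) /ball_eq.
  case: ifP => uS; case: ifP => vS; rewrite ?orbF ?orbT //=.
    by case: (eqVneq (quot u)) => // eqq; rewrite eqq vS in uS.
  by case: (eqVneq (quot u)) => // eqq; rewrite -eqq uS in vS.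
(* Doubling the exponent turns the ball into its product with itself. *)
rewrite expnS mul2n -addnn expgD; apply: wl_step_ball_eq IHh _ _.
by rewrite (subsetP (expgs_mono (leq0n _))) ?expg0 ?inE.
Qed.

Lemma wl_stable_cayley h :
  wl_stable (cayley_config S) h = (#|~: (S ^+ (2 ^ h)%N)| <= 1).
Proof.
set B := S ^+ _.
have sB : B \subset S ^+ (2 ^ h.+1)%N.
  by apply: expgs_mono; rewrite leq_exp2l.
apply/preim_partition_eqP/idP => [eqker | /card_le1_eqP out1 u v].
  have kerB q r : ball_eq (S ^+ (2 ^ h.+1)%N) q r = ball_eq B q r.
    have := eqker (1, q) (1, r); rewrite !wl_iter_cayley /quot /=.
    by rewrite invg1 !mulg1.
  rewrite leqNgt; apply/negP => /card_gt1P[x [y [xB yB neq]]].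
  rewrite !inE in xB yB.
  have fixB : S ^+ (2 ^ h.+1)%N = B.
    (* An element [z] of the larger ball outside [B] is alone in its new class, hence alone outside
       [B], against [x != y]. *)
    apply/eqP; rewrite eqEsubset sB andbT; apply/subsetP => z zBB.
    apply: contraT => zB.
    have eqz r : r \notin B -> r = z.
      by move=> rB; apply/eqP; rewrite -(ball_eq_in _ zBB) kerB ball_eq_notin.
    by rewrite (eqz x) // (eqz y) // eqxx in neq.
  (* The exponent [(2 ^ h).+1] lies between [2 ^ h] and [2 ^ h.+1], where the powers agree. *)
  have: S ^+ (2 ^ h).+1 = B.
    apply/eqP; rewrite eqEsubset [X in _ && X]expgs_mono // andbT -fixB.
    by rewrite expgs_mono // ltn_exp2l.
  by move/expgs_fix=> fullB; rewrite /B fullB inE in xB.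
have eqB (A : {set gT}) q r : B \subset A -> ball_eq A q r = (q == r).
  move=> sBA; rewrite /ball_eq; case: eqVneq => //= neq.
  have notinB x : x \notin A -> x \in ~: B.
    by rewrite inE; apply: contra; exact: (subsetP sBA).
  by apply: contraNF neq => /andP[/notinB qB /notinB rB]; apply/eqP/out1.
by rewrite !wl_iter_cayley !eqB.
Qed.

End Cayley.

Theorem theorem3 (gT : finGroupType) (S : {set gT})
    (genS : <<S>>%g = [set: gT]) (e_in_S : 1%g \in S) (symS : S = S^-1%g) :
  WL (cayley_config S) =
    if unique_antipodes S then up_log 2 (diam (cayley S) - 1)
    else up_log 2 (diam (cayley S)).
Proof.
(* The boolean, coerced to 0 or 1, merges both cases into one logarithm. *)
transitivity (up_log 2 (diam (cayley S) - unique_antipodes S)); last first.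
  by case: unique_antipodes; rewrite ?subn0.
have stableE h : wl_stable (cayley_config S) h
               = (diam (cayley S) - unique_antipodes S <= 2 ^ h).
  by rewrite wl_stable_cayley // card_setC_expgs_leq1.
(* Both sides are the least [h] with the bound at most [2 ^ h]; a bound of 0 gives 0 on both. *)
rewrite /WL; case: ex_minnP => h; rewrite stableE => leh minh.
by apply/eqP; rewrite eqn_leq up_log_min // minh // stableE up_logP.
Qed.
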